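(* For all positive integers $n,k,s$, $$\left\lfloor\!\!\left\lfloor\begin{matrix} n\\ k\end{matrix}\right\rfloor\!\!\right\rfloor_{s}\ \ge\ \left\lceil\!\!\left\lceil\begin{matrix} n\\ k\end{matrix}\right\rceil\!\!\right\rceil_{s}.$$
   Context: For a partition $\pi=\{b_1,\dots,b_k\}$ of $[n]=\{1,\dots,n\}$ into non-empty blocks, $\operatorname{bl}\pi=\{\min b_1,\dots,\min b_k\}$ (minima with respect to the usual order of integers). A list is a linearly ordered block. The Lah number with higher level (level $s$), $\left\lfloor\!\!\left\lfloor\begin{matrix} n\\ k\end{matrix}\right\rfloor\!\!\right\rfloor_{s}$, is the number of ordered $s$-tuples $(\pi_1,\dots,\pi_s)$ of partitions of $[n]$ into $k$ non-empty lists with $\operatorname{bl}\pi_1=\dots=\operatorname{bl}\pi_s$. The Stirling number of the first kind with higher level, $\left[\!\left[\begin{matrix} n\\ k\end{matrix}\right]\!\right]_{s}$ (resp. of the second kind, $\left\{\!\left\{\begin{matrix} n\\ k\end{matrix}\right\}\!\right\}_{s}$), is the number of ordered $s$-tuples $(\pi_1,\dots,\pi_s)$ of partitions of $[n]$ into $k$ non-empty cyclically ordered blocks (resp. $k$ non-empty unordered blocks) with $\operatorname{bl}\pi_1=\dots=\operatorname{bl}\pi_s$. Equivalently (known), they are determined for $n,k\ge1$ by $\left[\!\left[\begin{matrix} n\\ k\end{matrix}\right]\!\right]_{s}=\left[\!\left[\begin{matrix} n-1\\ k-1\end{matrix}\right]\!\right]_{s}+(n-1)^s\left[\!\left[\begin{matrix}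 n-1\\ k\end{matrix}\right]\!\right]_{s}$ and $\left\{\!\left\{\begin{matrix} n\\ k\end{matrix}\right\}\!\right\}_{s}=\left\{\!\left\{\begin{matrix} n-1\\ k-1\end{matrix}\right\}\!\right\}_{s}+k^s\left\{\!\left\{\begin{matrix} n-1\\ k\end{matrix}\right\}\!\right\}_{s}$, both being $1$ at $(n,k)=(0,0)$ and $0$ at $(n,0)$ and $(0,n)$ for $n>0$. The Lah numbers of order $s$ are defined for integers $n,k\ge0$, $s\ge1$ by $$\left\lceil\!\!\left\lceil\begin{matrix} n\\ k\end{matrix}\right\rceil\!\!\right\rceil_{s}=\sum_{j=k}^{n}\left[\!\left[\begin{matrix} n\\ j\end{matrix}\right]\!\right]_{s}\left\{\!\left\{\begin{matrix} j\\ k\end{matrix}\right\}\!\right\}_{s},$$ and are $0$ for $n<k$. *)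

(* Defs.v *)
From mathcomp Require Import all_boot all_fingroup.

Set Implicit Arguments.
Unset Strict Implicit.
Unset Printing Implicit Defensive.

(* The ground set [n] = {1, ..., n} is 'I_n = {0, ..., n-1}, with the order of
   the integers; the shift by one does not affect the numbers counted below. *)

Definition bl (n : nat) (P : {set {set 'I_n}}) : {set 'I_n} :=
  [set i : 'I_n | [exists B in P, (i \in B) && [forall j in B, i <= j]]].

(* Number of s-tuples of structures of type T satisfying p, all having the same
   set of block minima; blocks x is the underlying set partition of x. *)
Definition same_bl_tuples (n : nat) (T : finType) (p : pred T)
    (blocks : T -> {set {set 'I_n}}) (s : nat) : nat :=
  #|[set t : s.-tuple T |
      [forall i : 'I_s, p (tnth t i)]
      && [forall i : 'I_s, forall j : 'I_s,
            bl (blocks (tnth t i)) == bl (blocks (tnth t j))]]|.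

(* A list is a non-empty duplicate-free sequence; the bound n on the length is
   implied by duplicate-freeness and only makes the type finite. *)
Definition list_partition (n : nat) (L : {set n.-bseq 'I_n}) : bool :=
  [forall l in L, (0 < size l) && uniq l]
  && [forall i : 'I_n, #|[set l in L | i \in l]| == 1].

Definition list_blocks (n : nat) (L : {set n.-bseq 'I_n}) :
    {set {set 'I_n}} :=
  [set [set i : 'I_n in l] | l : n.-bseq 'I_n in L].

Definition lah_higher_level (s n k : nat) : nat :=
  same_bl_tuples (fun L : {set n.-bseq 'I_n} =>
    list_partition L && (#|L| == k)) (@list_blocks n) s.

(* A partition of [n] into cyclically ordered blocks is a permutation of [n],
   its blocks being the cycles: each element is sent to the next one in the
   cyclic order of its block. *)
Definition stirling1_higher_level (s n k : nat) : nat :=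
  same_bl_tuples (fun u : {perm 'I_n} => #|porbits u| == k)
    (fun u : {perm 'I_n} => porbits u) s.

Definition stirling2_higher_level (s n k : nat) : nat :=
  same_bl_tuples (fun P : {set {set 'I_n}} =>
    partition P [set: 'I_n] && (#|P| == k)) id s.

(* The sum is empty, hence 0, when n < k. *)
Definition lah_order (s n k : nat) : nat :=
  \sum_(k <= j < n.+1)
     stirling1_higher_level s n j * stirling2_higher_level s j k.

(* Main.v *)
Require Import Defs.
From mathcomp Require Import all_boot all_fingroup.

(** The inequality comes from an injection that acts on s-tuples entry by entry.

    For s = 1 it is the classical decomposition of a partition into lists.
    Given a permutation u with j cycles and a partition P of the set of these
    cycles, turn each block of P into a list by writing every cycle of the
    block from its minimum on, the cycles following one another by decreasing
    minimum (Foata's correspondence).  A cycle then begins exactly at each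
    left-to-right minimum of the list, so the list alone gives the cycles back
    ([flatten_runs_inj]); all the lists together give u ([glue_perm_inj]),
    hence the number j, and then P ([glue_inj]).

    Numbering the cycles of u by increasing minimum turns P into a partition of
    'I_j.  The minimum of a list is the minimum of the cycle with the smallest
    number in its block of P, so the set of minima of the lists depends only on
    the set of minima of the cycles of u and on the set of minima of the blocks
    of P ([bl_glue]).  This is what makes the construction work for all s: a
    tuple of permutations with common minima, paired with a tuple of partitions
    with common minima, gives a tuple of list partitions with common minima.
    These tuples are distinct for distinct pairs, also when the pairs have
    different values of j, since s > 0 leaves at least one entry from which to
    read j ([glue_tuple_level]).  For s > 1 the map is not onto: the lists of
    two entries may have the same minima while the cycles inside them do not. *)

Set Implicit Arguments.
Unset Strict Implicit.
Unset Printing Implicit Defensive.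

(** * Ranking a set of integers *)

Lemma sorted_enum_ord n (A : {set 'I_n}) :
  sorted (fun x y : 'I_n => x < y) (enum A).
Proof.
(* [enum] unfolds to a filter of the increasing enumeration of ['I_n]. *)
have -> : enum A = [seq x <- enum 'I_n | x \in A] by rewrite enumT.
apply: sorted_filter => [y x z|]; first exact: ltn_trans.
by rewrite -(sorted_map (f := val) (e' := ltn)) val_enum_ord iota_ltn_sorted.
Qed.

(** Elements are numbered from 0 upwards, so that the numbering of the cycles of
    a permutation by increasing minimum lands in ['I_j], where j is the number
    of cycles; working over ['I_n.+1] supplies the default value. *)
Definition nth_elt (n : nat) (A : {set 'I_n.+1}) (i : nat) : 'I_n.+1 :=
  nth ord0 (enum A) i.

Lemma mem_nth_elt n (A : {set 'I_n.+1}) i : i < #|A| -> nth_elt A i \in A.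
Proof. by move=> lt_iA; rewrite -mem_enum mem_nth // -cardE. Qed.

Lemma nth_elt_onto n (A : {set 'I_n.+1}) x :
  x \in A -> exists2 i, i < #|A| & nth_elt A i = x.
Proof.
rewrite -mem_enum => xA; exists (index x (enum A)); last exact: nth_index.
by rewrite cardE index_mem.
Qed.

Lemma nth_elt_mono n (A : {set 'I_n.+1}) i j :
  i < j -> j < #|A| -> nth_elt A i < nth_elt A j.
Proof.
move=> lt_ij lt_jA.
have ltr : transitive (fun x y : 'I_n.+1 => x < y).
  by move=> y x z; apply: ltn_trans.
apply: (sorted_ltn_nth ltr ord0 (sorted_enum_ord A)) => //; rewrite inE -cardE //.
exact: ltn_trans lt_jA.
Qed.

Lemma leq_nth_elt n (A : {set 'I_n.+1}) i j :
  i < #|A| -> j < #|A| -> (nth_elt A i <= nth_elt A j) = (i <= j).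
Proof.
move=> iA jA; case: (ltngtP i j) => [lt_ij|lt_ji|->]; last exact: leqnn.
  exact/ltnW/nth_elt_mono.
by apply/negbTE; rewrite -ltnNge nth_elt_mono.
Qed.

Lemma nth_elt_inj n (A : {set 'I_n.+1}) i j :
  i < #|A| -> j < #|A| -> nth_elt A i = nth_elt A j -> i = j.
Proof.
move=> iA jA eq_ij; apply/eqP.
by rewrite eqn_leq -(leq_nth_elt iA jA) -(leq_nth_elt jA iA) eq_ij leqnn.
Qed.

(** * Block minima *)

Lemma mem_blP n (P : {set {set 'I_n}}) i :
  reflect (exists B, [/\ B \in P, i \in B & forall j, j \in B -> i <= j])
          (i \in bl P).
Proof.
rewrite inE; apply: (iffP exists_inP) => [[B PB /andP[iB /forall_inP le_iB]]|].
  by exists B.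
by case=> B [PB iB le_iB]; exists B => //; rewrite iB; apply/forall_inP.
Qed.

Lemma bl_porbits_min n (u : {perm 'I_n}) c x :
  c \in bl (porbits u) -> x \in porbit u c -> c <= x.
Proof.
case/mem_blP=> _ [/imsetP[z _ ->] cz le_c] xc; apply: le_c.
by rewrite -eq_porbit_mem in cz; rewrite -(eqP cz).
Qed.

Lemma bl_porbits_inj n (u : {perm 'I_n}) c d x :
    c \in bl (porbits u) -> d \in bl (porbits u) ->
  x \in porbit u c -> x \in porbit u d -> c = d.
Proof.
move=> uc ud; rewrite -!eq_porbit_mem => /eqP-> /eqP cd; apply/val_inj/eqP.
rewrite eqn_leq (bl_porbits_min uc) ?(bl_porbits_min ud) //.
  by rewrite -cd porbit_id.
by rewrite cd porbit_id.
Qed.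

Lemma bl_porbits_cover n (u : {perm 'I_n}) x :
  exists2 c, c \in bl (porbits u) & x \in porbit u c.
Proof.
case: (@arg_minnP _ x (mem (porbit u x)) val (porbit_id u x)) => c cx le_c.
exists c; last by rewrite porbit_sym.
by apply/mem_blP; exists (porbit u x); split; rewrite ?imset_f.
Qed.

(** Each cycle has exactly one minimum, so the numbers of the block minima of a
    permutation with j cycles range over the whole of ['I_j]. *)
Lemma card_bl_porbits n (u : {perm 'I_n}) : #|bl (porbits u)| = #|porbits u|.
Proof.
have def_u : porbits u = porbit u @: bl (porbits u).
  apply/setP=> C; apply/imsetP/imsetP=> [[x _ ->]|[c _ ->]]; last by exists c.
  have [c uc] := bl_porbits_cover u x; rewrite -eq_porbit_mem => /eqP->.
  by exists c.
rewrite [in RHS]def_u card_in_imset // => c d uc ud eq_cd.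
by apply: (bl_porbits_inj uc ud (porbit_id u c)); rewrite -eq_cd porbit_id.
Qed.

(** * Unique factorisation at left-to-right minima *)

(** A cycle written from its minimum on: its first letter is smaller than all
    the others. *)
Definition run (n : nat) (w : seq 'I_n) : bool :=
  if w is c :: t then all (fun x : 'I_n => c < x) t else false.

Definition drops (n : nat) (v w : seq 'I_n) : bool :=
  if (v, w) is (c :: _, d :: _) then d < c else false.

(** The first run of a concatenation stops where a letter smaller than its head
    appears: no such letter occurs inside the run, and the next run, if any,
    starts with one. *)
Lemma take_run n (c : 'I_n) t ss :
    all (@run n) ((c :: t) :: ss) -> path (@drops n) (c :: t) ss ->
  take (find (fun x : 'I_n => x < c) (t ++ flatten ss)) (t ++ flatten ss) = t.
Proof.
case/andP=> run_t run_ss drops_ss.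
have not_t : has (fun x : 'I_n => x < c) t = false.
  apply/negbTE; rewrite -all_predC; apply: sub_all run_t => x /=.
  by rewrite -leqNgt => /ltnW.
rewrite find_cat not_t.
suffices -> : find (fun x : 'I_n => x < c) (flatten ss) = 0.
  by rewrite addn0 take_size_cat.
case: ss run_ss drops_ss {not_t} => [|[|d v] ss] //= _ /andP[lt_dc _].
by rewrite (lt_dc : d < c).
Qed.

(** The runs of decreasing heads are cut out by the left-to-right minima of
    their concatenation, which depend on the concatenation alone. *)
Lemma flatten_runs_inj n (ss ss' : seq (seq 'I_n)) :
    all (@run n) ss -> sorted (@drops n) ss ->
    all (@run n) ss' -> sorted (@drops n) ss' ->
  flatten ss = flatten ss' -> ss = ss'.
Proof.
elim: ss ss' => [|[|c t] ss IHss] [|[|c' t'] ss'] //= run_ss drops_ss.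
move=> run_ss' drops_ss' [eq_c eq_flat]; subst c'.
have eq_t : t = t'.
  by rewrite -(take_run run_ss drops_ss) -(take_run run_ss' drops_ss') eq_flat.
subst t'; congr (_ :: _); apply: IHss.
- by case/andP: run_ss.
- exact: path_sorted drops_ss.
- by case/andP: run_ss'.
- exact: path_sorted drops_ss'.
by have := congr1 (drop (size t)) eq_flat; rewrite !drop_size_cat.
Qed.

(** * Words of cycles *)

Definition cycle_word (n : nat) (u : {perm 'I_n}) (c : 'I_n) : seq 'I_n :=
  traject u c #|porbit u c|.

Lemma cycle_wordE n (u : {perm 'I_n}) c :
  cycle_word u c = c :: behead (cycle_word u c).
Proof.
rewrite /cycle_word; case def_m: #|porbit u c| => [|m] //.
by have := card_porbit_neq0 u c; rewrite def_m.
Qed.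

Lemma run_cycle_word n (u : {perm 'I_n}) c :
  c \in bl (porbits u) -> run (cycle_word u c).
Proof.
move=> uc; rewrite cycle_wordE; apply/allP=> x xt.
have uniq_c : uniq (cycle_word u c) by apply: uniq_traject_porbit.
have xc : x \in porbit u c.
  by rewrite porbit_traject -/(cycle_word u c) cycle_wordE inE xt orbT.
rewrite ltn_neqAle (bl_porbits_min uc xc) andbT.
move: uniq_c; rewrite cycle_wordE => /andP[c_t _]; apply: contraNneq c_t => eq_cx.
by move: xt; rewrite -(val_inj eq_cx).
Qed.

Lemma drops_cycle_word n (u : {perm 'I_n}) c d :
  drops (cycle_word u c) (cycle_word u d) = (d < c).
Proof. by rewrite (cycle_wordE u c) (cycle_wordE u d). Qed.

(** The word of a cycle, read cyclically, determines the permutation on that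
    cycle; equal words therefore force equal values. *)
Lemma next_cycle_word n (u : {perm 'I_n}) c x :
  x \in porbit u c -> next (cycle_word u c) x = u x.
Proof.
rewrite porbit_traject -/(cycle_word u c) => xc; apply/eqP; rewrite eq_sym.
apply: (@next_cycle _ (frel u)) xc.
have := iter_porbit u c; rewrite /cycle_word.
case: #|porbit u c| => [|m] //= iter_c.
(* Closing the cycle: the last step of the path returns to [c]. *)
rewrite -[X in rcons _ X]iter_c -iterS iterSr -trajectSr; exact: fpath_traject.
Qed.

(** * Gluing the cycles of a permutation along a partition of its cycles *)

(** The numbers of the cycles are taken in decreasing order, so that the heads
    of the successive cycle words decrease. *)
Definition block_cycles (n : nat) (u : {perm 'I_n.+1}) j (B : {set 'I_j}) :=
  [seq cycle_word u (nth_elt (bl (porbits u)) b) | b : 'I_j <- rev (enum B)].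

Definition block_list (n : nat) (u : {perm 'I_n.+1}) j (B : {set 'I_j}) :
    n.+1.-bseq 'I_n.+1 :=
  insub_bseq n.+1 (flatten (block_cycles u B)).

Definition glue (n : nat) (u : {perm 'I_n.+1}) j (P : {set {set 'I_j}}) :
    {set n.+1.-bseq 'I_n.+1} :=
  [set block_list u B | B in P].

Section Gluing.

Variables (n j : nat) (u : {perm 'I_n.+1}).
Hypothesis card_u : #|porbits u| = j.

Local Notation chief b := (nth_elt (bl (porbits u)) b).

Let ltn_bl (b : 'I_j) : b < #|bl (porbits u)|.
Proof. by rewrite card_bl_porbits card_u. Qed.

Let chief_bl (b : 'I_j) : chief b \in bl (porbits u).
Proof. exact: mem_nth_elt. Qed.

Lemma chief_cover x : exists b : 'I_j, x \in porbit u (chief b).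
Proof.
have [c /nth_elt_onto[i lt_i <-] xc] := bl_porbits_cover u x.
by rewrite card_bl_porbits card_u in lt_i; exists (Ordinal lt_i).
Qed.

Lemma chief_porbit_inj (b b' : 'I_j) x :
  x \in porbit u (chief b) -> x \in porbit u (chief b') -> b = b'.
Proof.
move=> xb xb'; apply/val_inj/(nth_elt_inj (ltn_bl b) (ltn_bl b')).
exact: bl_porbits_inj xb xb'.
Qed.

Lemma mem_flatten_block (B : {set 'I_j}) x :
  reflect (exists2 b : 'I_j, b \in B & x \in porbit u (chief b))
          (x \in flatten (block_cycles u B)).
Proof.
apply: (iffP flattenP) => [[w /mapP[b]]|[b Bb xb]].
  by rewrite mem_rev mem_enum => Bb -> xw; exists b; rewrite ?porbit_traject.
exists (cycle_word u (chief b)); last by rewrite -porbit_traject.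
by apply/mapP; exists b; rewrite ?mem_rev ?mem_enum.
Qed.

Lemma uniq_flatten_block (B : {set 'I_j}) : uniq (flatten (block_cycles u B)).
Proof.
rewrite /block_cycles.
have: uniq (rev (enum B)) by rewrite rev_uniq enum_uniq.
elim: (rev _) => //= b s IHs /andP[b_s uniq_s].
rewrite cat_uniq uniq_traject_porbit IHs // andbT.
apply/hasPn=> x /flattenP[_ /mapP[b' s_b' ->] xb'].
apply: contra b_s; rewrite -!porbit_traject in xb' * => xb.
by rewrite (chief_porbit_inj xb xb').
Qed.

(** Duplicate-freeness bounds the length of the concatenation by n + 1, hence
    the truncation built into [insub_bseq] never happens. *)
Lemma block_listE (B : {set 'I_j}) :
  block_list u B = flatten (block_cycles u B) :> seq _.
Proof.
rewrite val_insubd; case: ifP => // /negP[].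
by rewrite -(card_uniqP (uniq_flatten_block B)) -[X in _ <= X]card_ord max_card.
Qed.

Lemma mem_block_list (B : {set 'I_j}) x :
  reflect (exists2 b : 'I_j, b \in B & x \in porbit u (chief b)) (x \in block_list u B).
Proof.
have -> : (x \in block_list u B) = (x \in flatten (block_cycles u B)).
  by rewrite -block_listE.
exact: mem_flatten_block.
Qed.

(** The list of [B] contains a cycle as soon as it meets it, and it tells which
    cycles are in [B]; this is how [B] is read off from its list. *)
Lemma mem_block_list_porbit (B : {set 'I_j}) (b : 'I_j) x :
  x \in porbit u (chief b) -> (x \in block_list u B) = (b \in B).
Proof.
move=> xb; apply/mem_block_list/idP => [[b' Bb' xb']|Bb]; last by exists b.
by rewrite (chief_porbit_inj xb xb').
Qed.

Lemma block_list_inj : injective (fun B : {set 'I_j} => block_list u B).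
Proof.
move=> B B' eq_BB'; apply/setP=> b.
by rewrite -!(mem_block_list_porbit _ (porbit_id u (chief b))) eq_BB'.
Qed.

Lemma glue_inj (P P' : {set {set 'I_j}}) : glue u P = glue u P' -> P = P'.
Proof. exact/imset_inj/block_list_inj. Qed.

Lemma card_glue (P : {set {set 'I_j}}) : #|glue u P| = #|P|.
Proof. exact/card_imset/block_list_inj. Qed.

Lemma list_partition_glue (P : {set {set 'I_j}}) :
  partition P [set: 'I_j] -> list_partition (glue u P).
Proof.
case/and3P=> /eqP covP trivP P'0; apply/andP; split.
  apply/forall_inP=> _ /imsetP[B PB ->].
  rewrite block_listE uniq_flatten_block andbT.
  have /set0Pn[b Bb] : B != set0 by apply: contraNneq P'0 => <-.
  have : chief b \in flatten (block_cycles u B).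
    by apply/mem_flatten_block; exists b; rewrite ?porbit_id.
  by case: (flatten _).
apply/forallP=> x; have [b xb] := chief_cover x.
have Pb : b \in cover P by rewrite covP inE.
apply/cards1P; exists (block_list u (pblock P b)); apply/setP=> l; rewrite !inE.
apply/andP/eqP=> [[/imsetP[B PB ->]]|->].
  by rewrite (mem_block_list_porbit _ xb) => Bb; rewrite (def_pblock trivP PB Bb).
by rewrite (mem_block_list_porbit _ xb) mem_pblock Pb imset_f ?pblock_mem.
Qed.

(** The right-hand side involves [u] only through its cycle minima and [P] only
    through [bl P].  It holds because numbers of cycles and minima of cycles
    are in the same order: the smallest letter of a list is the minimum of the
    cycle with the smallest number in the block. *)
Lemma bl_glue (P : {set {set 'I_j}}) :
  bl (list_blocks (glue u P)) = [set chief (b : 'I_j) | b in bl P].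
Proof.
have memB (B : {set 'I_j}) y :
    (y \in [set i in block_list u B]) = (y \in block_list u B) by rewrite inE.
apply/setP=> x; apply/mem_blP/imsetP.
  case=> _ [/imsetP[_ /imsetP[B PB ->] ->]]; rewrite memB => xB le_x.
  have chiefB (b : 'I_j) : b \in B -> x <= chief b.
    by move=> Bb; rewrite le_x // memB (mem_block_list_porbit _ (porbit_id _ _)).
  case/mem_block_list: xB => b Bb xb.
  have def_x : x = chief b.
    by apply/val_inj/eqP; rewrite eqn_leq chiefB // (bl_porbits_min _ xb).
  exists b => //; apply/mem_blP; exists B; split=> // b' Bb'.
  by rewrite -(leq_nth_elt (ltn_bl b) (ltn_bl b')) -def_x chiefB.
case=> b /mem_blP[B [PB Bb le_b]] ->.
exists [set i in block_list u B]; rewrite memB; split.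
- by rewrite imset_f ?imset_f.
- by rewrite (mem_block_list_porbit _ (porbit_id _ _)).
move=> y; rewrite memB => /mem_block_list[b' Bb' yb'].
apply: leq_trans (bl_porbits_min (chief_bl b') yb').
by rewrite (leq_nth_elt (ltn_bl b) (ltn_bl b')) le_b.
Qed.

Lemma runs_block_cycles (B : {set 'I_j}) : all (@run _) (block_cycles u B).
Proof. by apply/allP=> _ /mapP[b _ ->]; apply/run_cycle_word. Qed.

Lemma drops_block_cycles (B : {set 'I_j}) : sorted (@drops _) (block_cycles u B).
Proof.
rewrite sorted_map rev_sorted.
apply: sub_sorted (sorted_enum_ord B) => b b' lt_bb'.
by rewrite /= drops_cycle_word nth_elt_mono.
Qed.

End Gluing.

Lemma block_cycles_inj n j j' (u u' : {perm 'I_n.+1}) (B : {set 'I_j})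
    (B' : {set 'I_j'}) :
    #|porbits u| = j -> #|porbits u'| = j' ->
  block_list u B = block_list u' B' -> block_cycles u B = block_cycles u' B'.
Proof.
move=> uj uj' /(congr1 val); rewrite /= !block_listE //.
by apply: flatten_runs_inj;
  rewrite ?runs_block_cycles ?drops_block_cycles.
Qed.

(** The numbers of cycles of the two permutations may differ: this is what
    separates the images of the summands of [lah_order].  Every point lies in
    some list, the list determines its cycle words, and the word through the
    point determines the image of the point. *)
Lemma glue_perm_inj n j j' (u u' : {perm 'I_n.+1}) (P : {set {set 'I_j}})
    (P' : {set {set 'I_j'}}) :
    #|porbits u| = j -> #|porbits u'| = j' -> partition P [set: 'I_j] ->
  glue u P = glue u' P' -> u = u'.
Proof.
move=> uj uj' /and3P[/eqP covP _ _] eq_glue; apply/permP=> x.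
have [b xb] := chief_cover uj x.
have /bigcupP[B PB Bb] : b \in cover P by rewrite covP inE.
have : block_list u B \in glue u' P' by rewrite -eq_glue imset_f.
case/imsetP=> B' _ /(block_cycles_inj uj uj') eq_cycles.
have : cycle_word u (nth_elt (bl (porbits u)) b) \in block_cycles u' B'.
  by rewrite -eq_cycles; apply/mapP; exists b; rewrite ?mem_rev ?mem_enum.
case/mapP=> b' _ eq_w.
rewrite -(next_cycle_word xb) eq_w next_cycle_word //.
by rewrite porbit_traject -/(cycle_word _ _) -eq_w /cycle_word -porbit_traject.
Qed.

(** * Tuples *)

(** The set whose cardinality is [same_bl_tuples], by conversion. *)
Definition same_bl_set (n : nat) (T : finType) (p : pred T)
    (blocks : T -> {set {set 'I_n}}) (s : nat) : {set s.-tuple T} :=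
  [set t : s.-tuple T |
      [forall i : 'I_s, p (tnth t i)]
      && [forall i : 'I_s, forall j : 'I_s,
            bl (blocks (tnth t i)) == bl (blocks (tnth t j))]].

Lemma same_bl_setP n (T : finType) (p : pred T)
    (blocks : T -> {set {set 'I_n}}) s (t : s.-tuple T) :
  reflect ((forall i, p (tnth t i)) /\
           (forall i i', bl (blocks (tnth t i)) = bl (blocks (tnth t i'))))
          (t \in same_bl_set p blocks s).
Proof.
rewrite inE; apply: (iffP andP) => -[p_t bl_t].
  split=> [|i i']; first exact/forallP.
  by apply/eqP; move/forallP/(_ i)/forallP: bl_t; apply.
split; first exact/forallP.
by apply/forallP=> i; apply/forallP=> i'; apply/eqP.
Qed.

Definition glue_tuple (n s j : nat)
    (tP : s.-tuple {perm 'I_n.+1} * s.-tuple {set {set 'I_j}}) :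
    s.-tuple {set n.+1.-bseq 'I_n.+1} :=
  [tuple glue (tnth tP.1 i) (tnth tP.2 i) | i < s].

(** Its cardinality is the summand of index [j] in [lah_order]. *)
Definition glue_dom (n s k j : nat) :=
  setX (same_bl_set (fun u : {perm 'I_n.+1} => #|porbits u| == j)
          (fun u : {perm 'I_n.+1} => porbits u) s)
       (same_bl_set (fun P : {set {set 'I_j}} =>
          partition P [set: 'I_j] && (#|P| == k)) id s).

Lemma glue_tuple_inj n s k j :
  {in glue_dom n s k j &, injective (@glue_tuple n s j)}.
Proof.
move=> [t P] [t' P'] /setXP[/same_bl_setP[tj _] /same_bl_setP[Pk _]].
case/setXP=> /same_bl_setP[tj' _] _ eq_glue.
have eq_i i : tnth t i = tnth t' i /\ tnth P i = tnth P' i.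
  have := congr1 (fun x => tnth x i) eq_glue; rewrite !tnth_mktuple => eq_gi.
  have /andP[partP _] := Pk i.
  have eq_t := glue_perm_inj (eqP (tj i)) (eqP (tj' i)) partP eq_gi.
  split=> //; apply: (glue_inj (eqP (tj i))).
  by rewrite eq_gi eq_t.
by congr (_, _); apply: eq_from_tnth => i; case: (eq_i i).
Qed.

Lemma glue_tuple_level n s k j j' tP tP' :
    0 < s -> tP \in glue_dom n s k j -> tP' \in glue_dom n s k j' ->
  glue_tuple tP = glue_tuple tP' -> j = j'.
Proof.
case: tP tP' => [t P] [t' P'] s_gt0.
case/setXP=> /same_bl_setP[tj _] /same_bl_setP[Pk _].
case/setXP=> /same_bl_setP[tj' _] _ eq_glue.
pose i := Ordinal s_gt0.
have := congr1 (fun x => tnth x i) eq_glue; rewrite !tnth_mktuple => eq_gi.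
have /andP[partP _] := Pk i.
have eq_t := glue_perm_inj (eqP (tj i)) (eqP (tj' i)) partP eq_gi.
by have := tj i; rewrite [tnth _ _]eq_t (eqP (tj' i)) => /eqP.
Qed.

Lemma glue_tuple_same_bl n s k j tP :
    tP \in glue_dom n s k j ->
  glue_tuple tP \in same_bl_set (fun L : {set n.+1.-bseq 'I_n.+1} =>
    list_partition L && (#|L| == k)) (@list_blocks n.+1) s.
Proof.
case: tP => t P /setXP[/same_bl_setP[tj bl_t] /same_bl_setP[Pk bl_P]].
apply/same_bl_setP; split=> [i|i i']; rewrite !tnth_mktuple.
  have /andP[partP cardP] := Pk i.
  by rewrite (list_partition_glue (eqP (tj i))) //= (card_glue (eqP (tj i))).
by rewrite !bl_glue ?(eqP (tj _)) // (bl_t i i') (bl_P i i').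
Qed.

Theorem proposition4p1 (n k s : nat) (hn : 0 < n) (hk : 0 < k) (hs : 0 < s) :
  lah_higher_level s n k >= lah_order s n k.
Proof.
case: n hn => [//|n] _.
pose img (j : 'I_n.+2) := @glue_tuple n s j @: glue_dom n s k j.
have disj_img (j j' : 'I_n.+2) : j != j' -> [disjoint img j & img j'].
  move=> ne_jj'; apply/pred0P=> t; apply/negP.
  case/andP=> /imsetP[tP dom_tP ->] /imsetP[tP' dom_tP' eq_t].
  by case/eqP: ne_jj'; apply/val_inj/(glue_tuple_level hs dom_tP dom_tP' eq_t).
apply: (@leq_trans #|\bigcup_j img j|); last first.
  apply/subset_leq_card/bigcupsP=> j _; apply/subsetP=> _ /imsetP[tP dom_tP ->].
  exact: glue_tuple_same_bl dom_tP.
(* The summands with [j < k] are discarded. *)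
rewrite -sum1_card (partition_disjoint_bigcup _ _ disj_img) /lah_order.
rewrite big_geq_mkord big_mkcond; apply: leq_sum => j _; case: ifP => // _.
by rewrite sum1_card (card_in_imset (@glue_tuple_inj n s k j)) cardsX.
Qed.
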